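(* Let $\mathfrak C$ be a left cancellative small category. The following are equivalent: (i) $I_l\,\bar\ltimes\,\Omega$ is effective; (ii) $\mathfrak C^{*,0}\,\bar\ltimes\,\Omega$ is effective; (iii) For all $\mathfrak v\in\mathfrak C^0$, $u\in\mathfrak v\mathfrak C^*\mathfrak v$ and $f_1,\dots,f_n\in\mathcal J$ with $f_i\subsetneq\mathfrak v\mathfrak C$ for all $1\le i\le n$: if $uz\in z\mathfrak C^*$ for all $z\in\mathfrak v\mathfrak C\setminus\bigcup_{i=1}^nf_i$, then $ux=x$ for all $x\in\mathfrak v\mathfrak C\setminus\bigcup_{i=1}^nf_i$.
   Context: $\mathfrak C$ denotes the set of morphisms, $\mathfrak C^0\subseteq\mathfrak C$ the identity morphisms (identified with objects), $\mathfrak d,\mathfrak t$ domain and target; $cd$ is defined iff $\mathfrak d(c)=\mathfrak t(d)$; left cancellative means $cx=cy\Rightarrow x=y$. For $S\subseteq\mathfrak C$, $cS=\{cs:s\in S,\mathfrak t(s)=\mathfrak d(c)\}$. $\mathfrak C^*$ is the set of invertible elements, $\mathfrak v\mathfrak C^*\mathfrak v$ the set of $u\in\mathfrak C^*$ with $\mathfrak t(u)=\mathfrak d(u)=\mathfrak v$, and $\mathfrak C^{*,0}=\{u\in\mathfrak C^*:\mathfrak t(u)=\mathfrak d(u)\}$. Each $c\in\mathfrak C$ gives the partial bijection $\mathfrak d(c)\mathfrak C\to c\mathfrak C$, $x\mapsto cx$, again denoted $c$; $I_l$ is the smallest semigroup of partial bijections of $\mathfrak C$ containing these and closed under inverses;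 $\mathcal J=\{\mathrm{dom}(s):s\in I_l\}$ is its semilattice of idempotents (product = intersection, order = inclusion). $\bar{\mathcal J}$ is the set of subsets $\varepsilon=e\setminus\bigcup_{i=1}^nf_i$ of $\mathfrak C$ with $e,f_1,\dots,f_n\in\mathcal J$, $f_i\subseteq e$. $\widehat{\mathcal J}$ is the space of non-zero multiplicative maps $\chi:\mathcal J\to\{0,1\}$ with $\chi(\emptyset)=0$ if $\emptyset\in\mathcal J$ (pointwise convergence). $\Omega\subseteq\widehat{\mathcal J}$ consists of those $\chi$ such that whenever $e=\bigcup_{i=1}^nf_i$ ($e,f_i\in\mathcal J$) and $\chi(e)=1$, then $\chi(f_i)=1$ for some $i$. For $\chi\in\Omega$ and $\varepsilon=e\setminus\bigcup f_i\in\bar{\mathcal J}$, put $\chi(\varepsilon)=1$ iff $\chi(e)=1$ and $\chi(f_i)=0$ for all $i$, and $\chi(\varepsilon)=0$ otherwise (well defined). $s\in I_l$ acts by $\chi\mapsto s.\chi=\chi(s^{-1}\cdot s)$ from $\Omega(s^{-1}s)=\{\chi\in\Omega:\chi(s^{-1}s)=1\}$ onto $\Omega(ss^{-1})$. $I_l\,\bar\ltimes\,\Omega$ is the groupoid of classes $[s,\chi]^{\bar\sim}$ with $s\in I_l$, $\chi\in\Omega(s^{-1}s)$, where $(s,\chi)\bar\sim(t,\psi)$ iff $\chi=\psi$ and there is $\varepsilon\in\bar{\mathcal J}$ with $\chi(\varepsilon)=1$ and $s\varepsilon=t\varepsilon$ (equality of restrictions to $\varepsilon$ as partial bijections); source $\chi$,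 range $s.\chi$, $[s,t.\chi]^{\bar\sim}[t,\chi]^{\bar\sim}=[st,\chi]^{\bar\sim}$; topology such that the sets $\{[s,\chi]^{\bar\sim}:\chi\in\Omega(s^{-1}s)\}$ are open and mapped homeomorphically onto $\Omega(s^{-1}s)$ by the source map. $\mathfrak C^{*,0}\,\bar\ltimes\,\Omega:=\{[u,\chi]^{\bar\sim}:u\in\mathfrak C^{*,0}\}$, an open subgroupoid. An étale groupoid $\mathcal G$ is effective if the interior of its isotropy subgroupoid equals $\mathcal G^{(0)}$. *)

(* Defs.v *)
From HB Require Import structures.
From mathcomp Require Import all_boot all_classical.
From mathcomp Require Import topology_structure initial_topology subtype_topology.
From mathcomp Require Import product_topology subspace_topology bool_topology.
From mathcomp Require Import function_spaces topology.

Set Implicit Arguments.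
Unset Strict Implicit.
Unset Printing Implicit Defensive.

Local Open Scope classical_set_scope.
Local Open Scope quotient_scope.

(* Arrows-only presentation of small categories: an object is identified with
   its identity morphism, [dmn] and [tgt] take values in identities. The
   composite [compose c d] is meaningful only when [dmn c = tgt d]; outside of
   this case its value is unspecified and never used. *)
HB.mixin Record isSmallCategory (C : Type) := {
  dmn : C -> C;
  tgt : C -> C;
  compose : C -> C -> C;
  dmn_dmn : forall c, dmn (dmn c) = dmn c;
  tgt_dmn : forall c, tgt (dmn c) = dmn c;
  dmn_tgt : forall c, dmn (tgt c) = tgt c;
  tgt_tgt : forall c, tgt (tgt c) = tgt c;
  comp_dmn : forall c, compose c (dmn c) = c;
  comp_tgt : forall c, compose (tgt c) c = c;
  dmn_comp : forall c d, dmn c = tgt d -> dmn (compose c d) = dmn d;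
  tgt_comp : forall c d, dmn c = tgt d -> tgt (compose c d) = tgt c;
  compA : forall b c d, dmn b = tgt c -> dmn c = tgt d ->
    compose b (compose c d) = compose (compose b c) d
}.

#[short(type=smallCategory)]
HB.structure Definition SmallCategory := { C of isSmallCategory C }.

HB.mixin Record isLeftCancellative C of SmallCategory C := {
  comp_cancel : forall c x y : C, dmn c = tgt x -> dmn c = tgt y ->
    compose c x = compose c y -> x = y
}.

#[short(type=lcSmallCategory)]
HB.structure Definition LCSmallCategory :=
  { C of isLeftCancellative C & SmallCategory C }.

Section CategoryNotions.
Variable C : smallCategory.

Definition identities : set C := [set v | dmn v = v].

Definition lmulset (c : C) (S : set C) : set C :=
  [set compose c s | s in [set s | S s /\ tgt s = dmn c]].

Definition rideal (c : C) : set C := lmulset c setT.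

Definition invertibles : set C :=
  [set u | exists w : C, [/\ dmn u = tgt w, dmn w = tgt u,
                             compose u w = tgt u & compose w u = dmn u]].

Definition loop_invertibles : set C :=
  [set u | invertibles u /\ tgt u = dmn u].

Definition invertibles_at (v : C) : set C :=
  [set u | invertibles u /\ tgt u = v /\ dmn u = v].

Definition isotropy : set C := [set g | dmn g = tgt g].

End CategoryNotions.

Arguments identities : clear implicits.
Arguments invertibles : clear implicits.
Arguments loop_invertibles : clear implicits.
Arguments isotropy : clear implicits.

HB.mixin Record isGroupoid G of SmallCategory G := {
  ginv : G -> G;
  dmn_ginv : forall g : G, dmn (ginv g) = tgt g;
  tgt_ginv : forall g : G, tgt (ginv g) = dmn g;
  comp_ginv : forall g : G, compose g (ginv g) = tgt g;
  ginv_comp : forall g : G, compose (ginv g) g = dmn g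
}.

#[short(type=groupoid)]
HB.structure Definition Groupoid := { G of isGroupoid G & SmallCategory G }.

(* [dmn_etale] says that [dmn] is a local homeomorphism. *)
HB.mixin Record isEtale G of Topological G & Groupoid G := {
  comp_continuous :
    {within [set p : G * G | dmn p.1 = tgt p.2],
      continuous (fun p : G * G => compose p.1 p.2)};
  ginv_continuous : continuous (@ginv G);
  dmn_continuous : continuous (@dmn G);
  dmn_etale : forall g : G, exists U : set G,
    [/\ open U, U g, {in U &, injective (@dmn G)} &
        forall V : set G, V `<=` U -> open V -> open (@dmn G @` V)]
}.

#[short(type=etaleGroupoid)]
HB.structure Definition EtaleGroupoid :=
  { G of isEtale G & Topological G & Groupoid G }.

Definition effective (G : etaleGroupoid) : Prop :=
  interior (isotropy G) = identities G.

(* Open subgroupoids, with the subspace topology. *)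
Record open_subgroupoid (G : etaleGroupoid) := OpenSubgroupoid {
  sub_set :> set G;
  sub_open : open sub_set;
  sub_dmn : forall g, sub_set g -> sub_set (dmn g);
  sub_ginv : forall g, sub_set g -> sub_set (ginv g);
  sub_comp : forall g h, dmn g = tgt h -> sub_set g -> sub_set h ->
    sub_set (compose g h)
}.

Definition sub_carrier (G : etaleGroupoid) (H : open_subgroupoid G) : Type :=
  set_type (sub_set H).

HB.instance Definition _ (G : etaleGroupoid) (H : open_subgroupoid G) :=
  Topological.copy (sub_carrier H) (set_type (sub_set H)).

Section SubgroupoidInstance.
Variables (G : etaleGroupoid) (H : open_subgroupoid G).
Local Notation T := (sub_carrier H).

Definition sub_val (g : T) : G := set_val g.

Lemma sub_valP (g : T) : sub_set H (sub_val g).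
Proof. exact: set_valP. Qed.

Lemma sub_val_inj : injective sub_val.
Proof. by move=> g h /val_inj. Qed.

Definition sub_mk (g : G) (Hg : sub_set H g) : T := exist _ g (mem_set Hg).

Lemma sub_tgt (g : G) : sub_set H g -> sub_set H (tgt g).
Proof. by move=> Hg; rewrite -dmn_ginv; apply/sub_dmn/sub_ginv. Qed.

Definition sdmn (g : T) : T := sub_mk (sub_dmn (sub_valP g)).
Definition stgt (g : T) : T := sub_mk (sub_tgt (sub_valP g)).
Definition sginv (g : T) : T := sub_mk (sub_ginv (sub_valP g)).
Definition scomp (g h : T) : T :=
  match pselect (dmn (sub_val g) = tgt (sub_val h)) with
  | left E => sub_mk (sub_comp E (sub_valP g) (sub_valP h))
  | right _ => g
  end.

Lemma sub_valcomp (g h : T) : dmn (sub_val g) = tgt (sub_val h) ->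
  sub_val (scomp g h) = compose (sub_val g) (sub_val h).
Proof. by rewrite /scomp; case: pselect. Qed.

Lemma sdmn_eq (g h : T) : sdmn g = stgt h -> dmn (sub_val g) = tgt (sub_val h).
Proof. by move=> /(congr1 sub_val). Qed.

Fact sdd c : sdmn (sdmn c) = sdmn c. Proof. exact/sub_val_inj/dmn_dmn. Qed.
Fact std c : stgt (sdmn c) = sdmn c. Proof. exact/sub_val_inj/tgt_dmn. Qed.
Fact sdt c : sdmn (stgt c) = stgt c. Proof. exact/sub_val_inj/dmn_tgt. Qed.
Fact stt c : stgt (stgt c) = stgt c. Proof. exact/sub_val_inj/tgt_tgt. Qed.
Fact scd c : scomp c (sdmn c) = c.
Proof. by apply: sub_val_inj; rewrite sub_valcomp ?comp_dmn ?tgt_dmn. Qed.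
Fact sct c : scomp (stgt c) c = c.
Proof. by apply: sub_val_inj; rewrite sub_valcomp ?comp_tgt ?dmn_tgt. Qed.
Fact sdc c d : sdmn c = stgt d -> sdmn (scomp c d) = sdmn d.
Proof.
move=> /sdmn_eq E; apply: sub_val_inj; rewrite -[LHS]/(dmn (sub_val _)).
by rewrite sub_valcomp ?dmn_comp.
Qed.
Fact stc c d : sdmn c = stgt d -> stgt (scomp c d) = stgt c.
Proof.
move=> /sdmn_eq E; apply: sub_val_inj; rewrite -[LHS]/(tgt (sub_val _)).
by rewrite sub_valcomp ?tgt_comp.
Qed.
Fact scA b c d : sdmn b = stgt c -> sdmn c = stgt d ->
  scomp b (scomp c d) = scomp (scomp b c) d.
Proof.
move=> /sdmn_eq E /sdmn_eq F; apply: sub_val_inj.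
by rewrite !sub_valcomp ?compA// ?dmn_comp ?tgt_comp.
Qed.

HB.instance Definition _ := isSmallCategory.Build T
  sdd std sdt stt scd sct sdc stc scA.

Fact sdi (g : T) : dmn (sginv g) = tgt g.
Proof. exact/sub_val_inj/dmn_ginv. Qed.
Fact sti (g : T) : tgt (sginv g) = dmn g.
Proof. exact/sub_val_inj/tgt_ginv. Qed.
Fact sci (g : T) : compose g (sginv g) = tgt g.
Proof.
apply: sub_val_inj; rewrite -[compose _ _]/(scomp g (sginv g)).
by rewrite sub_valcomp ?comp_ginv ?tgt_ginv.
Qed.
Fact sic (g : T) : compose (sginv g) g = dmn g.
Proof.
apply: sub_val_inj; rewrite -[compose _ _]/(scomp (sginv g) g).
by rewrite sub_valcomp ?ginv_comp ?dmn_ginv.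
Qed.

HB.instance Definition _ := isGroupoid.Build T sdi sti sci sic.

Lemma sub_val_continuous : continuous sub_val.
Proof. exact: initial_continuous. Qed.

Lemma sub_openP (V : set T) : open V <-> open (sub_val @` V).
Proof.
split=> [[W oW <-]|oV].
  suff -> : sub_val @` (set_val @^-1` W) = W `&` sub_set H.
    by apply: openI => //; exact: sub_open.
  apply/seteqP; split=> [_ [g Wg <-]|g [Wg Hg]].
    by split=> //; exact: sub_valP.
  by exists (sub_mk Hg).
by exists (sub_val @` V) => //; apply/seteqP; split=> [g [h Vh /sub_val_inj <-]//|g Vg]; exists g.
Qed.

Lemma sub_continuous (X : topologicalType) (f : X -> T) :
  continuous (sub_val \o f) -> continuous f.
Proof. exact: continuous_comp_initial. Qed.

Lemma sub_nbhsE (g : T) (V : set G) :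
  nbhs (sub_val g) V -> nbhs g (sub_val @^-1` V).
Proof. exact: sub_val_continuous. Qed.

Fact sub_comp_continuous :
  {within [set p : T * T | dmn p.1 = tgt p.2],
    continuous (fun p : T * T => compose p.1 p.2)}.
Proof.
apply/subspace_continuousP => -[g h] /= E; have Egh := sdmn_eq E.
have /subspace_continuousP/(_ (sub_val g, sub_val h) Egh) cG :=
  @comp_continuous G.
move=> A [/= _ [[W oW <-]] /= Wgh] /filterS; apply.
have {}Wgh : W (compose (sub_val g) (sub_val h)) by rewrite -sub_valcomp.
have := cG W (open_nbhs_nbhs (conj oW Wgh)).
move=> [[P Q] [/= /sub_nbhsE Pg /sub_nbhsE Qh] PQ].
exists (sub_val @^-1` P, sub_val @^-1` Q) => //= -[a b] /= [Pa Qb] ab.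
have Eab := sdmn_eq ab.
have : W (compose (sub_val a) (sub_val b)).
  exact: (PQ (sub_val a, sub_val b) (conj Pa Qb) Eab).
by rewrite -(sub_valcomp Eab).
Qed.

Fact sub_ginv_continuous : continuous (@ginv T).
Proof.
apply: sub_continuous => g.
apply: (@continuous_comp _ _ _ sub_val (@ginv G)).
  exact: sub_val_continuous.
exact: ginv_continuous.
Qed.

Fact sub_dmn_continuous : continuous (@dmn T).
Proof.
apply: sub_continuous => g.
apply: (@continuous_comp _ _ _ sub_val (@dmn G)).
  exact: sub_val_continuous.
exact: dmn_continuous.
Qed.

Fact sub_dmn_etale (g : T) : exists U : set T,
  [/\ open U, U g, {in U &, injective (@dmn T)} &
      forall V : set T, V `<=` U -> open V -> open (@dmn T @` V)].
Proof.
have [U [oU Ug Uinj Uop]] := dmn_etale (sub_val g).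
exists (sub_val @^-1` U); split => //.
- by apply: open_comp => // x _; exact: sub_val_continuous.
- move=> a b /set_mem Ua /set_mem Ub /(congr1 sub_val) ab.
  by apply: sub_val_inj; apply: Uinj; rewrite ?inE.
- move=> V VU /sub_openP oV; apply/sub_openP.
  suff -> : sub_val @` (@dmn T @` V) = @dmn G @` (sub_val @` V).
    by apply: Uop => // _ [x Vx <-]; exact: VU.
  apply/seteqP; split=> [_ [_ [x Vx <-] <-]|_ [_ [x Vx <-] <-]].
    by exists (sub_val x) => //; exists x.
  by exists (dmn x) => //; exists x.
Qed.

HB.instance Definition _ := isEtale.Build T
  sub_comp_continuous sub_ginv_continuous sub_dmn_continuous sub_dmn_etale.

End SubgroupoidInstance.

Record pbij (T : Type) := PBij {
  graph :> T -> T -> Prop;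
  pbij_fun : forall x y y', graph x y -> graph x y' -> y = y';
  pbij_inj : forall x x' y, graph x y -> graph x' y -> x = x'
}.

Lemma pbijP (T : Type) (s t : pbij T) :
  (forall x y, s x y <-> t x y) -> s = t.
Proof.
case: s t => [s s1 s2] [t t1 t2] /= st.
have E : s = t by apply/funext => x; apply/funext => y; exact/propext.
by subst t; congr PBij; exact: Prop_irrelevance.
Qed.

Section PartialBijections.
Variable T : Type.
Implicit Types s t : pbij T.

Definition pdom s : set T := [set x | exists y, s x y].

Program Definition pmul s t : pbij T :=
  @PBij T (fun x z => exists2 y, t x y & s y z) _ _.
Next Obligation.
by move=> s t x z z' [y txy syz] [y']; move=> /(pbij_fun txy) <-; apply: pbij_fun.
Qed.
Next Obligation.
move=> s t x x' z [y txy syz] [y' + sy'z].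
by rewrite -(pbij_inj syz sy'z); exact: pbij_inj.
Qed.

Program Definition pinv s : pbij T := @PBij T (fun x y => s y x) _ _.
Next Obligation. by move=> s x y y'; exact: pbij_inj. Qed.
Next Obligation. by move=> s x y y'; exact: pbij_fun. Qed.

Program Definition pid (A : set T) : pbij T :=
  @PBij T (fun x y => A x /\ x = y) _ _.
Next Obligation. by move=> A x y y' [_ <-] [_ <-]. Qed.
Next Obligation. by move=> A x y y' [_ ->] [_ ->]. Qed.

Definition restr s (A : set T) : pbij T := pmul s (pid A).

Definition ppre s (A : set T) : set T := [set x | exists2 y, s x y & A y].

Lemma restrE s t A : restr s A = restr t A <->
  (forall x y, A x -> (s x y <-> t x y)).
Proof.
split=> [E x y Ax|E].
  have H : (restr s A x y <-> restr t A x y) by rewrite E.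
  split=> h.
    by have [|z [_ <-]] := H.1 _ => //; exists x.
  by have [|z [_ <-]] := H.2 _ => //; exists x.
by apply: pbijP => x y; split=> -[z [Ax <-]] /(E _ _ Ax) h; exists x.
Qed.

Lemma pdom_mul s t : pdom (pmul s t) = ppre t (pdom s).
Proof.
apply/seteqP; split=> [x [z [y txy syz]]|x [y txy [z syz]]].
  by exists y => //; exists z.
by exists z; exists y.
Qed.

Lemma pdom_invmul s : pdom (pmul (pinv s) s) = pdom s.
Proof.
apply/seteqP; split=> [x [_ [y xy _]]|x [y xy]]; first by exists y.
by exists x; exists y.
Qed.

End PartialBijections.

Section InverseSemigroup.
Variable C : lcSmallCategory.

(* The partial bijection [dmn c C -> c C], [x |-> c x]. *)
Program Definition lmul (c : C) : pbij C :=
  @PBij C (fun x y => dmn c = tgt x /\ y = compose c x) _ _.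
Next Obligation. by move=> c x y y' [_ ->] [_ ->]. Qed.
Next Obligation.
by move=> c x x' y [cx ->] [cx' E]; exact: comp_cancel E.
Qed.

Inductive Il : set (pbij C) :=
| Il_lmul c : Il (lmul c)
| Il_mul s t : Il s -> Il t -> Il (pmul s t)
| Il_inv s : Il s -> Il (pinv s).

Definition Jset : set (set C) := [set pdom s | s in Il].

Lemma Jset_pid (A : set C) : Jset A -> Il (pid A).
Proof.
case=> s sI <-; suff -> : pid (pdom s) = pmul (pinv s) s.
  by apply: Il_mul => //; exact: Il_inv.
apply: pbijP => x y; split=> [[[z xz] <-]|[z xz yz]]; first by exists z.
by split; [exists z | exact: pbij_inj xz yz].
Qed.

Lemma Jset_pre s (A : set C) : Il s -> Jset A -> Jset (ppre s A).
Proof.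
by move=> sI [t tI <-]; exists (pmul t s); [exact: Il_mul|exact: pdom_mul].
Qed.

Lemma Jset_cap (A B : set C) : Jset A -> Jset B -> Jset (A `&` B).
Proof.
move=> JA JB; have -> : A `&` B = ppre (pid A) B.
  apply/seteqP; split=> [x [Ax Bx]|x [y [Ax <-] Bx]] //.
  by exists x.
by apply: Jset_pre => //; exact: Jset_pid.
Qed.

(* [lc_semigroup] is the inverse semigroup I_l, [lc_semilattice] is J. *)
Definition lc_semigroup : Type := set_type Il.
Definition lc_semilattice : Type := set_type Jset.
Local Notation I := lc_semigroup.
Local Notation J := lc_semilattice.

Definition ival (s : I) : pbij C := set_val s.
Coercion ival : lc_semigroup >-> pbij.

Lemma ivalP (s : I) : Il s. Proof. exact: set_valP. Qed.
Lemma ival_inj : injective ival. Proof. by move=> s t /val_inj. Qed.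
Definition imk (s : pbij C) (h : Il s) : I := exist _ s (mem_set h).

Definition igen (c : C) : I := imk (Il_lmul c).
Definition imul (s t : I) : I := imk (Il_mul (ivalP s) (ivalP t)).
Definition iinv (s : I) : I := imk (Il_inv (ivalP s)).

Definition jval (e : J) : set C := set_val e.
Coercion jval : lc_semilattice >-> set.

Lemma jvalP (e : J) : Jset e. Proof. exact: set_valP. Qed.
Lemma jval_inj : injective jval. Proof. by move=> e f /val_inj. Qed.
Definition jmk (A : set C) (h : Jset A) : J := exist _ A (mem_set h).

Fact jdom_subproof (s : I) : Jset (pdom s).
Proof. by exists s => //; exact: ivalP. Qed.
Definition jdom (s : I) : J := jmk (jdom_subproof s).
Definition jcap (e f : J) : J := jmk (Jset_cap (jvalP e) (jvalP f)).
(* The domain of the idempotent [s^-1 e s], that is, the preimage of [e]. *)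
Definition jpre (s : I) (e : J) : J := jmk (Jset_pre (ivalP s) (jvalP e)).
Definition iid (e : J) : I := imk (Jset_pid (jvalP e)).

Definition Jbar : set (set C) :=
  [set eps | exists (e : J) (n : nat) (f : 'I_n -> J),
    (forall i, f i `<=` e) /\ eps = e `\` \bigcup_i f i].

Definition Jhat : set {ptws J -> bool} :=
  [set chi | [/\ exists e, chi e = true,
                 forall e f, chi (jcap e f) = chi e && chi f &
                 forall e : J, e = set0 :> set C -> chi e = false]].

Definition OmegaSet : set {ptws J -> bool} :=
  [set chi | Jhat chi /\
    forall (e : J) (n : nat) (f : 'I_n -> J),
      e = \bigcup_i f i :> set C -> chi e = true ->
      exists i, chi (f i) = true].

Definition Omega : Type := set_type OmegaSet.
HB.instance Definition _ := Topological.copy Omega (set_type OmegaSet).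

Definition oval (chi : Omega) : J -> bool := set_val chi.
Coercion oval : Omega >-> Funclass.

Lemma ovalP (chi : Omega) : OmegaSet chi. Proof. exact: set_valP. Qed.
Lemma oval_inj : injective oval. Proof. by move=> e f /val_inj. Qed.
Definition omk (chi : {ptws J -> bool}) (h : OmegaSet chi) : Omega :=
  exist _ chi (mem_set h).

(* [obar chi eps] stands for "chi(eps) = 1". It does not depend on the
   representation of [eps], see [obarP] below. *)
Definition obar (chi : Omega) (eps : set C) : Prop :=
  exists (e : J) (n : nat) (f : 'I_n -> J),
    [/\ (forall i, f i `<=` e), eps = e `\` \bigcup_i f i,
        chi e & forall i, ~~ chi (f i)].

Section OmegaTheory.
Implicit Types (chi : Omega) (e f : J).

Lemma ocap chi e f : chi (jcap e f) = chi e && chi f.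
Proof. by have [[_ H _] _] := ovalP chi; exact: H. Qed.

Lemma ocover (U : finType) chi e (f : U -> J) :
  e = \bigcup_i f i :> set C -> chi e -> exists i, chi (f i).
Proof.
move=> E che; have [_] := ovalP chi.
move=> /(_ e #|U| (f \o enum_val)) [||i]//; last by exists (enum_val i).
rewrite E; apply/seteqP; split=> [x [i _ fx]|x [i _ fx]].
  by exists (enum_rank i) => //=; rewrite enum_rankK.
by exists (enum_val i).
Qed.

Lemma ole chi e f : e `<=` f -> chi e -> chi f.
Proof.
move=> ef; have {1}-> : e = jcap e f.
  by apply: jval_inj; apply/seteqP; split=> x //; [split=> //; exact: ef|case].
by rewrite ocap => /andP[].
Qed.

Lemma obar_fin (U : finType) chi e (f : U -> J) (eps : set C) :
  (forall i, f i `<=` e) -> eps = e `\` \bigcup_i f i ->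
  chi e -> (forall i, ~~ chi (f i)) -> obar chi eps.
Proof.
move=> fe E che chf; exists e, #|U|, (f \o enum_val); split=> //=.
rewrite E; congr (_ `\` _); apply/seteqP; split=> [x [i _ fx]|x [i _ fx]].
  by exists (enum_rank i) => //=; rewrite enum_rankK.
by exists (enum_val i).
Qed.

Lemma obar_Jbar chi eps : obar chi eps -> Jbar eps.
Proof. by move=> [e [n [f [fe E _ _]]]]; exists e, n, f. Qed.

Lemma obar_sub chi eps (U : finType) e (f : U -> J) : obar chi eps ->
  eps `<=` e `\` \bigcup_i f i -> chi e /\ forall i, ~~ chi (f i).
Proof.
move=> [e' [n [f' [fe' E che' chf']]]] sub; split=> [|j].
  pose g (i : option 'I_n) := if i is Some i then f' i else jcap e' e.
  have cov : e' = \bigcup_i g i :> set C.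
    apply/seteqP; split=> [x ex|x [[i|] _]]; last by case.
      have [[i _ fx]|nf] := pselect ((\bigcup_i f' i) x).
        by exists (Some i).
      by exists None => //; split=> //; have [] : (e `\` \bigcup_i f i) x
        by apply: sub; rewrite E.
    exact: fe'.
  have [[i|]] := ocover cov che'; rewrite /g; first by rewrite (negbTE (chf' i)).
  by rewrite ocap => /andP[].
apply/negP => chfj.
pose g i := jcap (jcap (f j) e') (f' i).
have cov : jcap (f j) e' = \bigcup_i g i :> set C.
  apply/seteqP; split=> [x [fx ex]|x [i _ []//]].
  have [[i _ f'x]|nf] := pselect ((\bigcup_i f' i) x); first by exists i.
  have [_ []] : (e `\` \bigcup_i f i) x by apply: sub; rewrite E.
  by exists j.
have [|i] := @ocover _ chi _ g cov; first by rewrite ocap chfj.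
by rewrite /g !ocap => /andP[_]; rewrite (negbTE (chf' i)).
Qed.

Lemma obarP chi (n : nat) e (f : 'I_n -> J) : (forall i, f i `<=` e) ->
  obar chi (e `\` \bigcup_i f i) <->
  (chi e = true /\ forall i, chi (f i) = false).
Proof.
move=> fe; split=> [/obar_sub/(_ (@subset_refl _ _))[che chf]|[che chf]].
  by split=> // i; apply/negbTE.
by exists e, n, f; split=> // i; rewrite chf.
Qed.

Lemma obarI chi eps del : obar chi eps -> obar chi del ->
  obar chi (eps `&` del).
Proof.
move=> [e [n [f [fe -> che chf]]]] [e' [n' [f' [fe' -> che' chf']]]].
pose g (i : 'I_n + 'I_n') :=
  match i with inl i => jcap (f i) e' | inr i => jcap (f' i) e end.
apply: (@obar_fin _ chi (jcap e e') g).
- by case=> i x [fx ex]; split=> //; [exact: fe fx|exact: fe' fx].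
- apply/seteqP; split=> [x [[ex nf] [ex' nf']]|x [[ex ex'] nf]].
    by split=> // -[[i|i] _ []] *; [apply: nf|apply: nf']; exists i.
  by split; split=> // -[i _ fx]; apply: nf; [exists (inl i)|exists (inr i)].
- by rewrite ocap che.
- by case=> i; rewrite /g ocap negb_and ?chf ?chf'.
Qed.

Lemma obarJ chi e : chi e -> obar chi e.
Proof.
move=> che; exists e, 0, (fun i : 'I_0 => e); split=> [[]//||//|[]//].
apply/seteqP; split=> [x ex|x []//].
by split=> // -[[]].
Qed.

Lemma obar_le chi eps e : obar chi eps -> eps `<=` e -> chi e.
Proof.
move=> oe sub; have [] // := @obar_sub chi eps void e (of_void _) oe.
by move=> x /sub ex; split=> // -[[]].
Qed.

Lemma obarW chi eps del : obar chi eps -> Jbar del -> eps `<=` del ->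
  obar chi del.
Proof.
by move=> oe [e [n [f [fe ->]]]] /(obar_sub oe)[che chf]; exists e, n, f.
Qed.

Lemma onz chi : exists e, chi e.
Proof. by have [[]] := ovalP chi. Qed.

Lemma oeval_continuous e : continuous (fun chi : Omega => chi e : bool).
Proof.
move=> chi; apply: (@continuous_comp _ _ _
  (set_val : Omega -> {ptws J -> bool}) (fun psi : {ptws J -> bool} => psi e)).
  exact: initial_continuous.
exact: (@proj_continuous J (fun=> bool) e).
Qed.

Lemma onear chi e : \forall psi \near chi, (psi : Omega) e = chi e.
Proof.
have : nbhs (chi e) [set chi e] by rewrite nbhs_principalE.
by move=> /(oeval_continuous (x := chi)).
Qed.

Lemma obar_near chi eps : obar chi eps ->
  \forall psi \near chi, obar psi eps.
Proof.
move=> [e [n [f [fe E che chf]]]].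
have H : \forall psi \near chi, forall i, (psi : Omega) (f i) = chi (f i).
  exact: (@filter_forall Omega _ (fun i psi => psi (f i) = chi (f i)) _ _ (fun i => onear chi (f i))).
apply: filterS2 (onear chi e) H => psi He Hf.
by exists e, n, f; split=> // [|i]; rewrite ?He ?Hf.
Qed.

End OmegaTheory.

Section Action.
Implicit Types (s t : I) (chi : Omega).

Fact iact_subproof s chi : chi (jdom s) -> OmegaSet (fun e => chi (jpre s e)).
Proof.
move=> chs; split; first split.
- exists (jdom (iinv s)); apply: ole chs => x [y xy].
  by exists y => //; exists x.
- move=> e f; rewrite -ocap; congr (oval _ _); apply: jval_inj.
  apply/seteqP; split=> [x [y xy [ey fy]]|x [[y xy ey] [z /(pbij_fun xy) <-]]].
    by split; exists y.
  by exists y.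
- move=> e e0; have [[_ _ +] _] := ovalP chi; apply.
  by apply/seteqP; split=> // x [y _]; rewrite e0.
- move=> e n f E che; apply: ocover che => //.
  apply/seteqP; split=> [x [y xy]|x [i _ [y xy fy]]].
    by rewrite E => -[i _ fy]; exists i => //; exists y.
  by exists y => //; rewrite E; exists i.
Qed.

(* [s.chi = chi(s^-1 _ s)], for [chi] in [Omega(s^-1 s)]. *)
Definition iact s chi (h : chi (jdom s)) : Omega := omk (iact_subproof h).

Lemma iactE s chi (h : chi (jdom s)) e : iact h e = chi (jpre s e).
Proof. by []. Qed.

Lemma jdom_mul s t : jdom (imul s t) = jpre t (jdom s).
Proof. exact/jval_inj/pdom_mul. Qed.

Lemma obar_pre s chi (h : chi (jdom s)) eps :
  obar (iact h) eps -> obar chi (ppre s eps).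
Proof.
move=> [e [n [f [fe -> che chf]]]].
exists (jpre s e), n, (fun i => jpre s (f i)); split=> //.
- by move=> i x [y xy fy]; exists y => //; exact: fe fy.
- apply/seteqP; split=> [x [y xy [ey nf]]|x [[y xy ey] nf]].
    split; first by exists y.
    by move=> [i _ [z /(pbij_fun xy) <- fy]]; apply: nf; exists i.
  exists y => //; split=> // -[i _ fy].
  by apply: nf; exists i => //; exists y.
Qed.

Definition pgerm s t (chi : Omega) : Prop :=
  exists eps, [/\ Jbar eps, obar chi eps & restr s eps = restr t eps].

Lemma pgermP s t chi : pgerm s t chi <->
  exists2 eps, obar chi eps & forall x y, eps x -> (s x y <-> t x y).
Proof.
split=> [[eps [_ oe /restrE]]|[eps oe /restrE E]]; first by exists eps.
by exists eps; split=> //; exact: obar_Jbar oe.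
Qed.

Lemma pgerm_refl s chi : pgerm s s chi.
Proof. by apply/pgermP; have [e /obarJ] := onz chi; exists e. Qed.

Lemma pgerm_sym s t chi : pgerm s t chi -> pgerm t s chi.
Proof.
by move=> [eps [? ? ?]]; exists eps.
Qed.

Lemma pgerm_trans t s r chi : pgerm s t chi -> pgerm t r chi -> pgerm s r chi.
Proof.
move=> /pgermP[e oe E] /pgermP[f of_ F]; apply/pgermP; exists (e `&` f).
  exact: obarI.
by move=> x y [ex fx]; exact: iff_trans (E _ _ ex) (F _ _ fx).
Qed.

Lemma pgerm_dom s t chi : pgerm s t chi -> chi (jdom s) -> chi (jdom t).
Proof.
move=> /pgermP[e oe E] chs; apply: (obar_le (obarI oe (obarJ chs))).
by move=> x [ex [y /(E _ _ ex) xy]]; exists y.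
Qed.

Lemma pgerm_act s t chi (hs : chi (jdom s)) (ht : chi (jdom t)) :
  pgerm s t chi -> iact hs = iact ht.
Proof.
move=> st; apply: oval_inj; apply/funext => e; rewrite !iactE.
have {st}/pgermP[f of_ F] := st.
apply/idP/idP=> /obarJ/(obarI of_)/obar_le; apply.
  by move=> x [fx [y /(F _ _ fx) xy ey]]; exists y.
by move=> x [fx [y /(F _ _ fx) xy ey]]; exists y.
Qed.

Lemma pgerm_inv s t chi (hs : chi (jdom s)) :
  pgerm s t chi -> pgerm (iinv s) (iinv t) (iact hs).
Proof.
move=> st; have ht := pgerm_dom st hs.
have {st}/pgermP[f of_ F] := st; apply/pgermP.
exists (ppre (iinv s) f).
  have [e [n [g [ge -> che chg]]]] := of_.
  pose ps := jpre (iinv s).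
  have pK (d : J) : chi (jpre s (ps d)) = chi d.
    apply/idP/idP.
      by apply: ole => x [y xy [z zy dz]]; rewrite (@pbij_inj _ s _ _ _ xy zy).
    move=> chd; apply: (obar_le (obarI (obarJ hs) (obarJ chd))).
    by move=> x [[y xy] dx]; exists y => //; exists x.
  exists (ps e), n, (ps \o g); split=> //=.
  - by move=> i y [x xy gx]; exists x => //; exact: ge gx.
  - apply/seteqP; split=> [y [x xy [ex nf]]|y [[x xy ex] nf]].
      split; first by exists x.
      by move=> [i _ [z /(@pbij_inj _ s _ _ _ xy) <- gx]]; apply: nf; exists i.
    exists x => //; split=> // -[i _ gx].
    by apply: nf; exists i => //; exists x.
  - by rewrite iactE pK.
  - by move=> i; rewrite iactE pK.
move=> y x [z zy fz]; have tzy := (F _ _ fz).1 zy.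
split=> [xy|xy].
  by rewrite /= -(@pbij_inj _ s _ _ _ zy xy).
by rewrite /= -(@pbij_inj _ t _ _ _ tzy xy).
Qed.

Lemma pgerm_mul s s' t t' chi (ht : chi (jdom t)) :
  pgerm s s' (iact ht) -> pgerm t t' chi -> pgerm (imul s t) (imul s' t') chi.
Proof.
move=> /pgermP[e /obar_pre oe E] /pgermP[f of_ F].
apply/pgermP; exists (ppre t e `&` f); first exact: obarI.
move=> x z [[y txy ey] fx]; split=> -[y' xy' yz]; exists y'.
- exact: (F _ _ fx).1 xy'.
- by apply: (E _ _ _).1 yz; rewrite -(pbij_fun txy xy').
- exact: (F _ _ fx).2 xy'.
- apply: (E _ _ _).2 yz.
  by rewrite -(pbij_fun txy ((F _ _ fx).2 xy')).
Qed.

End Action.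
End InverseSemigroup.

Arguments Il C : clear implicits.
Arguments Jset C : clear implicits.
Arguments Jbar C : clear implicits.
Arguments Jhat C : clear implicits.
Arguments OmegaSet C : clear implicits.

Section Germs.
Variable C : lcSmallCategory.
Local Notation I := (lc_semigroup C).
Local Notation J := (lc_semilattice C).
Local Notation Om := (Omega C).

Record pregerm : Type := PreGerm {
  pg_s : I;
  pg_chi : Om;
  pg_dom : pg_chi (jdom pg_s)
}.

HB.instance Definition _ := gen_eqMixin pregerm.
HB.instance Definition _ := gen_choiceMixin pregerm.

Definition germ_rel (p q : pregerm) : bool :=
  `[< pg_chi p = pg_chi q /\ pgerm (pg_s p) (pg_s q) (pg_chi p) >].

Fact germ_rel_refl : reflexive germ_rel.
Proof. by move=> p; apply/asboolP; split=> //; exact: pgerm_refl. Qed.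

Fact germ_rel_sym : symmetric germ_rel.
Proof.
by move=> p q; apply/asboolP/asboolP => -[E pq]; split=> //;
  apply: pgerm_sym; [rewrite -E|rewrite -E].
Qed.

Fact germ_rel_trans : transitive germ_rel.
Proof.
move=> q p r /asboolP[E pq] /asboolP[F qr]; apply/asboolP.
by split; [rewrite E|apply: pgerm_trans pq _; rewrite E].
Qed.

Canonical germ_equiv :=
  EquivRel germ_rel germ_rel_refl germ_rel_sym germ_rel_trans.

Definition germ : Type := {eq_quot germ_equiv}.
HB.instance Definition _ := Choice.on germ.
HB.instance Definition _ := Quotient.on germ.

Implicit Types (s t : I) (chi psi : Om) (g h : germ).

(* The class [s, chi]. *)
Definition mkgerm s chi (hs : chi (jdom s)) : germ := \pi_germ (PreGerm hs).

Lemma mkgermE s t chi psi (hs : chi (jdom s)) (ht : psi (jdom t)) :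
  mkgerm hs = mkgerm ht <-> chi = psi /\ pgerm s t chi.
Proof.
rewrite /mkgerm; split=> [E|E].
  by have /eqquotP/asboolP := E.
by apply/eqquotP/asboolP.
Qed.

Lemma mkgerm_irr s chi (h k : chi (jdom s)) : mkgerm h = mkgerm k.
Proof. by rewrite (Prop_irrelevance h k). Qed.

Lemma germP g : exists s chi (hs : chi (jdom s)), g = mkgerm hs.
Proof.
rewrite -[g]reprK; case: (repr g) => s chi hs.
by exists s, chi, hs.
Qed.

Definition gsrc g : Om := pg_chi (repr g).
Definition grng g : Om := iact (pg_dom (repr g)).

Lemma repr_mkgerm s chi (hs : chi (jdom s)) :
  chi = pg_chi (repr (mkgerm hs)) /\ pgerm s (pg_s (repr (mkgerm hs))) chi.
Proof.
apply/(mkgermE hs (pg_dom (repr (mkgerm hs)))).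
rewrite -[LHS]reprK; rewrite /mkgerm; congr (\pi _).
by case: repr.
Qed.

Lemma gsrc_mk s chi (hs : chi (jdom s)) : gsrc (mkgerm hs) = chi.
Proof. by have [] := repr_mkgerm hs. Qed.

Lemma grng_mk s chi (hs : chi (jdom s)) : grng (mkgerm hs) = iact hs.
Proof.
rewrite /grng; have [E st] := repr_mkgerm hs.
case: (repr _) E st => t psi ht /= E; subst psi => st.
exact/esym/pgerm_act.
Qed.

Lemma jdom_iid (e : J) : jdom (iid e) = e.
Proof.
apply: jval_inj; apply/seteqP; split=> [x [y []//]|x ex].
by exists x.
Qed.

Fact iid_dom chi (e : J) : chi e -> chi (jdom (iid e)).
Proof. by rewrite jdom_iid. Qed.

(* The unit at [chi]: the class of any idempotent of I_l whose domain [e]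
   satisfies [chi(e) = 1]. *)
Definition gunit chi : germ := mkgerm (iid_dom (projT2 (cid (onz chi)))).

Lemma gunitE s chi (hs : chi (jdom s)) :
  (forall x y, s x y -> x = y) -> mkgerm hs = gunit chi.
Proof.
move=> sid; apply/mkgermE; split=> //; apply/pgermP.
case: cid => e /= che.
exists (jdom s `&` e); first by apply: obarI; exact: obarJ.
move=> x y [[z xz] ex]; split=> [/sid <- //|[_ <-]].
by rewrite {2}(sid _ _ xz).
Qed.

Lemma gsrc_unit chi : gsrc (gunit chi) = chi.
Proof. exact: gsrc_mk. Qed.

Lemma iact_id s chi (hs : chi (jdom s)) :
  (forall x y, s x y -> x = y) -> iact hs = chi.
Proof.
move=> sid; apply: oval_inj; apply/funext => e; rewrite iactE.
apply/idP/idP.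
  by apply: ole => x [y /sid -> ].
move=> che; apply: (obar_le (obarI (obarJ hs) (obarJ che))).
move=> x [[y xy] ex]; exists y => //.
by rewrite -(sid _ _ xy).
Qed.

Lemma grng_unit chi : grng (gunit chi) = chi.
Proof. by rewrite /gunit grng_mk; apply: iact_id => x y []. Qed.

Fact imul_dom s t chi (ht : chi (jdom t)) :
  iact ht (jdom s) -> chi (jdom (imul s t)).
Proof. by rewrite jdom_mul. Qed.

Fact iinv_dom s chi (hs : chi (jdom s)) : iact hs (jdom (iinv s)).
Proof.
by rewrite iactE; apply: ole hs => x [y xy]; exists y => //; exists x.
Qed.

Fact gcomp_subproof (p q : pregerm) : pg_chi p = iact (pg_dom q) ->
  pg_chi q (jdom (imul (pg_s p) (pg_s q))).
Proof. by move=> E; apply: (imul_dom (ht := pg_dom q)); rewrite -E pg_dom. Qed.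

(* [s, t.chi] [t, chi] = [st, chi]; the value [g] is used when the source of
   [g] is not the range of [h]. *)
Definition gcomp g h : germ :=
  match pselect (gsrc g = grng h) with
  | left E => mkgerm (gcomp_subproof E)
  | right _ => g
  end.

Definition ginverse g : germ := mkgerm (iinv_dom (pg_dom (repr g))).

Lemma gcomp_mk s t chi (ht : chi (jdom t)) (hs : iact ht (jdom s))
    (hst : chi (jdom (imul s t))) :
  gcomp (mkgerm hs) (mkgerm ht) = mkgerm hst.
Proof.
rewrite /gcomp; case: pselect => [E|]; last by rewrite gsrc_mk grng_mk.
apply/mkgermE.
have [E1 st1] := repr_mkgerm hs; have [E2 st2] := repr_mkgerm ht.
rewrite -E2; split=> //; apply: pgerm_sym.
exact: (pgerm_mul (ht := ht)).
Qed.

Lemma ginverse_mk s chi (hs : chi (jdom s)) :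
  ginverse (mkgerm hs) = mkgerm (iinv_dom hs).
Proof.
rewrite /ginverse; have [E st] := repr_mkgerm hs.
case: (repr _) E st => t psi ht /= E; subst psi => st.
apply/mkgermE; split; first exact/esym/pgerm_act.
rewrite -(pgerm_act hs ht st); apply: pgerm_sym.
exact: pgerm_inv.
Qed.

Lemma iact_mul s t chi (ht : chi (jdom t)) (hs : iact ht (jdom s))
    (hst : chi (jdom (imul s t))) : iact hst = iact hs.
Proof.
apply: oval_inj; apply/funext => e; rewrite !iactE; congr (oval _ _).
apply: jval_inj; apply/seteqP; split=> [x [z [y xy yz] ez]|x [y xy [z yz ez]]].
  by exists y => //; exists z.
by exists z => //; exists y.
Qed.

Definition gdmn g : germ := gunit (gsrc g).
Definition gtgt g : germ := gunit (grng g).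

Lemma gunit_inj : injective gunit.
Proof. by move=> chi psi /(congr1 gsrc); rewrite !gsrc_unit. Qed.

Lemma composableP g h : gdmn g = gtgt h ->
  exists s t chi (ht : chi (jdom t)) (hs : iact ht (jdom s)),
    g = mkgerm hs /\ h = mkgerm ht.
Proof.
move=> /gunit_inj.
have [s [phi [hs ->]]] := germP g; have [t [chi [ht ->]]] := germP h.
rewrite gsrc_mk grng_mk => E; subst phi.
by exists s, t, chi, ht, hs.
Qed.

Fact gdd g : gdmn (gdmn g) = gdmn g.
Proof. by rewrite /gdmn gsrc_unit. Qed.
Fact gtd g : gtgt (gdmn g) = gdmn g.
Proof. by rewrite /gdmn /gtgt grng_unit. Qed.
Fact gdt g : gdmn (gtgt g) = gtgt g.
Proof. by rewrite /gdmn /gtgt gsrc_unit. Qed.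
Fact gtt g : gtgt (gtgt g) = gtgt g.
Proof. by rewrite /gtgt grng_unit. Qed.

Fact gcd g : gcomp g (gdmn g) = g.
Proof.
have E : gdmn g = gtgt (gdmn g) by rewrite gtd.
have [s [t [chi [ht [hs [-> Eh]]]]]] := composableP E.
move: Eh; rewrite /gdmn gsrc_mk => Eh.
have Echi : iact ht = chi.
  by have := congr1 gsrc Eh; rewrite gsrc_unit gsrc_mk.
have hst := imul_dom hs; rewrite Eh (gcomp_mk _ hst).
apply/mkgermE; split=> //.
have := hs; rewrite Echi => hs'.
have : mkgerm ht = gunit chi by rewrite -Eh Echi.
move=> /mkgermE[_ /pgermP[f of_ F]]; case: cid F => e /= che F.
apply/pgermP; exists (f `&` e); first by apply: obarI => //; exact: obarJ.
move=> x y [fx ex]; split=> [[z /(F _ _ fx)[_ <-]//]|sxy].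
by exists x => //; apply/(F _ _ fx).
Qed.

Fact gct g : gcomp (gtgt g) g = g.
Proof.
have [t [chi [ht ->]]] := germP g.
rewrite /gtgt grng_mk /gunit; case: cid => e /= hs.
have hst := imul_dom (iid_dom hs); rewrite (gcomp_mk _ hst).
apply/mkgermE; split=> //; apply/pgermP.
exists (jpre t e); first exact: obarJ.
move=> x y [z xz ez]; split=> [[z' xz' [_ <-]//]|xy].
exists y => //; split=> //.
by rewrite -(pbij_fun xz xy).
Qed.

Fact gdc g h : gdmn g = gtgt h -> gdmn (gcomp g h) = gdmn h.
Proof.
move=> /composableP[s [t [chi [ht [hs [-> ->]]]]]].
have hst := imul_dom hs.
by rewrite (gcomp_mk _ hst) /gdmn !gsrc_mk.
Qed.

Fact gtc g h : gdmn g = gtgt h -> gtgt (gcomp g h) = gtgt g.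
Proof.
move=> /composableP[s [t [chi [ht [hs [-> ->]]]]]].
have hst := imul_dom hs.
by rewrite (gcomp_mk _ hst) /gtgt !grng_mk (iact_mul hs).
Qed.

Fact gcA k g h : gdmn k = gtgt g -> gdmn g = gtgt h ->
  gcomp k (gcomp g h) = gcomp (gcomp k g) h.
Proof.
move=> kg /composableP[s [t [chi [ht [hs [Eg Eh]]]]]]; subst g h.
have [r [phi [hr Ek]]] := germP k; subst k.
move: kg => /gunit_inj; rewrite gsrc_mk grng_mk => E; subst phi.
have hst := imul_dom hs; have hrs := imul_dom hr.
rewrite (gcomp_mk _ hst) (gcomp_mk _ hrs).
have hrs_t := imul_dom hrs; rewrite (gcomp_mk _ hrs_t).
have E : iact hs = iact hst by rewrite (iact_mul hs).
have hr' : iact hst (jdom r) by rewrite -E.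
have -> : mkgerm hr = mkgerm hr'.
  by apply/mkgermE; split=> //; exact: pgerm_refl.
have hr_st := imul_dom hr'; rewrite (gcomp_mk _ hr_st).
apply/mkgermE; split=> //; apply/pgermP.
have [e che] := onz chi; exists e; first exact: obarJ.
move=> x w _; split=> [[z [y xy yz] zw]|[y xy [z yz zw]]].
  by exists y => //; exists z.
by exists z => //; exists y.
Qed.

HB.instance Definition _ := isSmallCategory.Build germ
  gdd gtd gdt gtt gcd gct gdc gtc gcA.

Fact gdi g : dmn (ginverse g) = tgt g.
Proof.
have [s [chi [hs ->]]] := germP g.
by rewrite ginverse_mk /dmn/= /tgt/= /gdmn /gtgt gsrc_mk grng_mk.
Qed.

Fact ginverse_act s chi (hs : chi (jdom s)) : iact (iinv_dom hs) = chi.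
Proof.
have hi : chi (jdom (imul (iinv s) s)).
  by apply: ole hs => x [y xy]; exists x; exists y.
rewrite -(iact_mul (iinv_dom hs) hi) iact_id// => x z [y xy zy].
exact: pbij_inj xy zy.
Qed.

Fact gti g : tgt (ginverse g) = dmn g.
Proof.
have [s [chi [hs ->]]] := germP g.
by rewrite ginverse_mk /dmn/= /tgt/= /gdmn /gtgt gsrc_mk grng_mk ginverse_act.
Qed.

Fact gic g : compose (ginverse g) g = dmn g.
Proof.
have [s [chi [hs ->]]] := germP g.
have hst := imul_dom (iinv_dom hs).
rewrite ginverse_mk /compose/= (gcomp_mk _ hst) /dmn/= /gdmn gsrc_mk.
by apply: gunitE => x z [y xy zy]; exact: pbij_inj xy zy.
Qed.

Lemma ginverseK : involutive ginverse.
Proof.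
move=> g; have [s [chi [hs ->]]] := germP g.
rewrite !ginverse_mk; apply/mkgermE; split; first exact: ginverse_act.
have -> : iinv (iinv s) = s by apply/ival_inj/pbijP.
exact: pgerm_refl.
Qed.

Fact gci g : compose g (ginverse g) = tgt g.
Proof. by have := gic (ginverse g); rewrite ginverseK gdi. Qed.

HB.instance Definition _ := isGroupoid.Build germ gdi gti gci gic.

End Germs.

Section GermTopology.
Variable C : lcSmallCategory.
Local Notation I := (lc_semigroup C).
Local Notation J := (lc_semilattice C).
Local Notation Om := (Omega C).
Local Notation germ := (germ C).
Implicit Types (s t : I) (chi psi : Om) (g h : germ).

Definition slice (s : I) (U : set Om) : set germ :=
  [set g | exists (chi : Om) (hs : chi (jdom s)), U chi /\ g = mkgerm hs].

(* The slices of open sets form a basis of the topology; [slice_open] and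
   [gsrc_slice_homeo] below show that it is the (unique) topology for which
   the sets {[s, chi] : chi in Omega(s^-1 s)} are open and mapped
   homeomorphically onto Omega(s^-1 s) by the source map. *)
Definition germ_open : set (set germ) :=
  [set W | forall g, W g -> exists (s : I) (U : set Om),
    [/\ open U, slice s U g & slice s U `<=` W]].

Fact germ_openT : germ_open setT.
Proof.
move=> g _; have [s [chi [hs ->]]] := germP g.
by exists s, setT; split=> //; [exact: openT|exists chi, hs].
Qed.

Fact germ_openI : setI_closed germ_open.
Proof.
move=> A B oA oB g [/oA[s [U [oU [chi [hs [Uchi Eg]]] UA]]]].
move=> /oB[t [V [oV [psi [ht [Vpsi Eg']]] VB]]].
move: Eg'; rewrite Eg => /mkgermE[E st].
subst psi; have [f [Jf of_ /restrE F]] := st.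
pose W := interior [set psi : Om | obar psi f].
exists s, (U `&` V `&` W); split.
- by apply: openI; [exact: openI|exact: open_interior].
- by exists chi, hs; split=> //; split=> //; exact: obar_near.
- move=> _ [psi [ks [[[Upsi Vpsi'] /interior_subset Wpsi] ->]]]; split.
    by apply: UA; exists psi, ks.
  have st' : pgerm s t psi by apply/pgermP; exists f.
  apply: VB; exists psi, (pgerm_dom st' ks); split=> //.
  by apply/mkgermE.
Qed.

Fact germ_open_bigU (K : Type) (f : K -> set germ) :
  (forall i, germ_open (f i)) -> germ_open (\bigcup_i f i).
Proof.
move=> fo g [i _ /fo[s [U [oU sg sf]]]].
by exists s, U; split=> // h /sf fh; exists i.
Qed.

HB.instance Definition _ := isOpenTopological.Build germ
  germ_openT germ_openI germ_open_bigU.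

Lemma germ_openE : open = germ_open :> set (set germ). Proof. by []. Qed.

Lemma slice_open s (U : set Om) : open U -> open (slice s U).
Proof. by move=> oU; rewrite germ_openE => g sg; exists s, U; split. Qed.

Lemma slice_nbhs s chi (hs : chi (jdom s)) (A : set germ) :
  nbhs (mkgerm hs) A ->
  exists U : set Om, [/\ open U, U chi & slice s U `<=` A].
Proof.
rewrite nbhsE => -[B []]; rewrite germ_openE => oB Bg BA.
have [t [V [oV [psi [ht [Vpsi /mkgermE[E st]]]] VB]]] := oB _ Bg.
subst psi; have [f [Jf of_ /restrE F]] := st.
exists (V `&` interior [set psi : Om | obar psi f]); split.
- by apply: openI => //; exact: open_interior.
- by split=> //; exact: obar_near.
- move=> _ [psi [ks [[Vpsi' /interior_subset Wpsi] ->]]]; apply/BA/VB.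
  have st' : pgerm s t psi by apply/pgermP; exists f.
  by exists psi, (pgerm_dom st' ks); split=> //; exact/mkgermE.
Qed.

Lemma nbhs_slice s chi (hs : chi (jdom s)) (A : set Om) :
  nbhs chi A -> nbhs (mkgerm hs) (slice s A).
Proof.
rewrite nbhsE => -[B [oB Bchi] BA].
apply: (@filterS _ _ _ (slice s B)).
  by move=> _ [psi [ks [Bpsi ->]]]; exists psi, ks; split=> //; exact: BA.
by apply: open_nbhs_nbhs; split; [exact: slice_open|exists chi, hs].
Qed.

Lemma gunit_continuous : continuous (@gunit C).
Proof.
move=> chi A; rewrite /gunit; case: cid => e /= che.
move=> /slice_nbhs[U [oU Uchi UA]].
apply: filterS2 (open_nbhs_nbhs (conj oU Uchi)) (onear chi e) => psi Upsi He.
apply: UA; have k : psi (jdom (iid e)) by rewrite jdom_iid He.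
by exists psi, k; split=> //; apply/esym/gunitE => x y [].
Qed.

Lemma gsrc_continuous : continuous (@gsrc C).
Proof.
move=> g A; have [s [chi [hs ->]]] := germP g; rewrite gsrc_mk => nA.
apply: filterS (nbhs_slice hs nA) => _ [psi [ks [Apsi ->]]].
by rewrite /= gsrc_mk.
Qed.

(* The source map sends the slice of [s] bijectively onto Omega(s^-1 s), and
   it is continuous and open there. *)
Lemma gsrc_slice_homeo s :
  [/\ @gsrc C @` slice s setT = [set chi : Om | chi (jdom s)],
      {in slice s setT &, injective (@gsrc C)},
      continuous (@gsrc C) &
      forall W : set germ, open W -> open (@gsrc C @` W)].
Proof.
split.
- apply/seteqP; split=> [_ [_ [chi [hs [_ ->]]] <-]|chi hs].
    by rewrite /= gsrc_mk.
  by exists (mkgerm hs); rewrite ?gsrc_mk//; exists chi, hs.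
- move=> _ _ /set_mem[chi [hs [_ ->]]] /set_mem[psi [ht [_ ->]]].
  by rewrite !gsrc_mk => E; subst psi; exact: mkgerm_irr.
- exact: gsrc_continuous.
- move=> W; rewrite germ_openE => oW; rewrite openE => _ [g Wg <-].
  have [t [U [oU [chi [ht [Uchi Eg]]] UW]]] := oW _ Wg.
  rewrite Eg gsrc_mk /interior.
  apply: filterS2 (open_nbhs_nbhs (conj oU Uchi)) (onear chi (jdom t)).
  move=> psi Upsi; rewrite ht => k; exists (mkgerm k); rewrite ?gsrc_mk//.
  by apply: UW; exists psi, k.
Qed.

Lemma iact_near s chi (hs : chi (jdom s)) (A : set Om) : nbhs (iact hs) A ->
  \forall psi \near chi, forall ks : (psi : Om) (jdom s), A (iact ks).
Proof.
pose f (psi : Om) : {ptws J -> bool} := fun e => psi (jpre s e).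
have fc : f @ nbhs chi --> (f chi : {ptws J -> bool}).
  apply/cvg_sup => e B [_ [[W oW <-]] We /filterS]; apply.
  exact: (oeval_continuous (e := jpre s e) (open_nbhs_nbhs (conj oW We))).
move=> [_ [/= [W oW <-]] /= Wchi WA].
have := fc W (open_nbhs_nbhs (conj oW Wchi)).
by apply: (@filterS _ (nbhs chi)) => psi Wpsi ks; apply: WA.
Qed.

Fact germ_comp_continuous :
  {within [set p : germ * germ | dmn p.1 = tgt p.2],
    continuous (fun p : germ * germ => compose p.1 p.2)}.
Proof.
apply/subspace_continuousP => -[g h] /= gh A /=.
have [s [t [chi [ht [hs [-> ->]]]]]] := composableP gh.
have hst := imul_dom hs.
rewrite -[nbhs _ A]/(nbhs (gcomp (mkgerm hs) (mkgerm ht)) A) (gcomp_mk _ hst).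
move=> /slice_nbhs[U [oU Uchi UA]].
exists (slice s setT, slice t U).
  split=> /=; first by apply: nbhs_slice; exact: filterT.
  by apply: nbhs_slice; exact: open_nbhs_nbhs.
move=> [a b] /= [[phi [ks [_ ->]]] [psi [kt [Upsi ->]]]] ab.
have := gunit_inj ab; rewrite gsrc_mk grng_mk => E; subst phi.
have kst := imul_dom ks.
rewrite -[A _]/(A (gcomp (mkgerm ks) (mkgerm kt))) (gcomp_mk _ kst); apply: UA.
by exists psi, kst.
Qed.

Fact germ_ginv_continuous : continuous (@ginv germ).
Proof.
move=> g A; have [s [chi [hs ->]]] := germP g.
rewrite /ginv/= ginverse_mk => /slice_nbhs[U [oU Uchi UA]].
have := iact_near (open_nbhs_nbhs (conj oU Uchi)).
move=> /(nbhs_slice hs); apply: filterS => _ [psi [ks [Uks ->]]] /=.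
by rewrite ginverse_mk; apply: UA; exists (iact ks), (iinv_dom ks).
Qed.

Fact germ_dmn_continuous : continuous (@dmn germ).
Proof.
move=> g; apply: (@continuous_comp _ _ _ (@gsrc C) (@gunit C)).
  exact: gsrc_continuous.
exact: gunit_continuous.
Qed.

Lemma gunit_open (U : set Om) : open U -> open (@gunit C @` U).
Proof.
rewrite germ_openE => oU _ [chi Uchi <-]; have [e che] := onz chi.
have he := iid_dom che.
have idE psi (k : psi (jdom (iid e))) : mkgerm k = gunit psi.
  by apply: gunitE => x y [].
exists (iid e), U; split=> //; first by exists chi, he.
by move=> _ [psi [k [Upsi ->]]]; exists psi.
Qed.

Fact germ_dmn_etale g : exists U : set germ,
  [/\ open U, U g, {in U &, injective (@dmn germ)} &
      forall V : set germ, V `<=` U -> open V -> open (@dmn germ @` V)].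
Proof.
have [s [chi [hs ->]]] := germP g; exists (slice s setT).
have [_ inj _ op] := gsrc_slice_homeo s; split.
- by apply: slice_open; exact: openT.
- by exists chi, hs.
- by move=> a b aS bS /gunit_inj; exact: inj.
- move=> V _ oV; suff -> : @dmn germ @` V = @gunit C @` (@gsrc C @` V).
    exact/gunit_open/op.
  by rewrite image_comp.
Qed.

HB.instance Definition _ := isEtale.Build germ
  germ_comp_continuous germ_ginv_continuous germ_dmn_continuous germ_dmn_etale.

Definition core_set : set germ :=
  [set g | exists (u : C) (chi : Om) (hu : chi (jdom (igen u))),
    loop_invertibles C u /\ g = mkgerm hu].

Lemma invertible_dmn (u : C) : invertibles C (dmn u).
Proof.
by exists (dmn u); split; rewrite ?dmn_dmn ?tgt_dmn//; have := comp_dmn (dmn u); rewrite dmn_dmn.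
Qed.

Lemma igenM (u w : C) : dmn u = tgt w ->
  imul (igen u) (igen w) = igen (compose u w).
Proof.
move=> uw; apply/ival_inj/pbijP => x z; split.
  move=> [_ [wx ->] [_ ->]]; split; first by rewrite dmn_comp.
  by rewrite compA.
move=> [+ ->]; rewrite dmn_comp// => wx; exists (compose w x) => //.
by split; [rewrite tgt_comp|rewrite compA].
Qed.

Lemma igenV (u w : C) : dmn u = tgt w -> dmn w = tgt u ->
  compose u w = tgt u -> compose w u = dmn u -> iinv (igen u) = igen w.
Proof.
move=> uw wu Euw Ewu; apply/ival_inj/pbijP => y x; split=> -[h ->].
  by split; rewrite ?tgt_comp// compA// Ewu h comp_tgt.
by split; rewrite ?tgt_comp// compA// Euw -wu h comp_tgt.
Qed.

Lemma onempty chi (e : J) : chi e -> exists x, (e : set C) x.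
Proof.
move=> che; apply: contrapT => ne.
have [[_ _ /(_ e) H] _] := ovalP chi.
have : chi e = false by apply: H; apply/seteqP; split=> x // ex; case: ne; exists x.
by rewrite che.
Qed.

Fact core_set_open : open core_set.
Proof.
rewrite germ_openE.
move=> _ [u [chi [hu [uL ->]]]]; exists (igen u), setT; split.
- exact: openT.
- by exists chi, hu.
- by move=> _ [psi [ku [_ ->]]]; exists u, psi, ku.
Qed.

Fact core_set_dmn g : core_set g -> core_set (dmn g).
Proof.
move=> [u [chi [hu [uL ->]]]]; rewrite /dmn/= /gdmn gsrc_mk.
have hd : chi (jdom (igen (dmn u))).
  apply: ole hu => x [y [ux _]]; exists x; rewrite /= dmn_dmn; split=> //.
  by rewrite ux comp_tgt.
exists (dmn u), chi, hd; split.
  by split; rewrite ?tgt_dmn ?dmn_dmn//; exact: invertible_dmn.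
apply/esym/gunitE => x y [+ ->]; rewrite dmn_dmn => ->.
by rewrite comp_tgt.
Qed.

Fact core_set_ginv g : core_set g -> core_set (ginv g).
Proof.
move=> [u [chi [hu [[[w [uw wu Euw Ewu]] ul] ->]]]].
rewrite /ginv/= ginverse_mk.
have E := igenV uw wu Euw Ewu; have hi := iinv_dom hu; move: hi (hi).
rewrite {1}E => hw hi; exists w, (iact hu), hw; split.
  split; last by rewrite -uw wu.
  by exists u; split; rewrite // ?Ewu ?Euw.
by apply/mkgermE; split=> //; rewrite E; exact: pgerm_refl.
Qed.

Fact core_set_comp g h : dmn g = tgt h -> core_set g -> core_set h ->
  core_set (compose g h).
Proof.
move=> gh [u [phi [hu [[[u' [uu' u'u Eu Eu']] ul] Eg]]]].
move=> [w [chi [hw [[[w' [ww' w'w Ew Ew']] wl] Eh]]]]; subst g h.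
have := gunit_inj gh; rewrite gsrc_mk grng_mk => E; subst phi.
have huw := imul_dom hu; rewrite /compose/= (gcomp_mk _ huw).
have [x [_ [y [wx ->] [uy _]]]] := onempty huw.
have uw : dmn u = tgt w by rewrite uy tgt_comp.
have hc := huw; rewrite (igenM uw) in hc.
exists (compose u w), chi, hc; split.
  split; last by rewrite tgt_comp// dmn_comp// ul -wl.
  have w'u' : dmn w' = tgt u' by rewrite w'w -uw.
  exists (compose w' u'); split.
  - by rewrite dmn_comp// tgt_comp.
  - by rewrite dmn_comp// tgt_comp.
  - rewrite tgt_comp// -compA ?tgt_comp// (compA w w' u') // Ew.
    by rewrite -uw uu' comp_tgt.
  - rewrite dmn_comp// -compA ?tgt_comp// (compA u' u w) // Eu'.
    by rewrite uw comp_tgt.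
by apply/mkgermE; split=> //; rewrite igenM//; exact: pgerm_refl.
Qed.

Definition core_subgroupoid : open_subgroupoid germ :=
  OpenSubgroupoid core_set_open core_set_dmn core_set_ginv core_set_comp.

End GermTopology.

Arguments core_subgroupoid : clear implicits.

(* The groupoid of germs of I_l acting on Omega. *)
Definition Il_groupoid (C : lcSmallCategory) : etaleGroupoid := germ C.

(* Its open subgroupoid of classes [u, chi] with [u] invertible such that
   [tgt u = dmn u]. *)
Definition core_groupoid (C : lcSmallCategory) : etaleGroupoid :=
  sub_carrier (core_subgroupoid C).

(* Main.v *)
Require Import Defs.
From mathcomp Require Import all_boot all_classical.
From mathcomp Require Import topology.

Set Implicit Arguments.
Unset Strict Implicit.
Unset Printing Implicit Defensive.

Local Open Scope classical_set_scope.

(** An element of I_l commutes with right multiplication: it sends [x y] to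
    [s(x) y]. Every ideal in J is therefore a right ideal, so each morphism
    [z] gives a point of Omega, the principal character with value 1 on the
    ideals that contain [z], and these points are dense: a neighbourhood of
    [chi] contains all the principal characters of the elements of some set
    [eps] with [chi(eps) = 1]. The partial bijection [s] carries the principal
    character of [z] to that of [s(z)], and the principal characters of [z]
    and [w] agree exactly when [w] lies in [z C^*].

    Effectiveness says that an open set of isotropy consists of units. It
    passes to open subgroupoids ([effective_sub]), which gives (i) => (ii).

    For (ii) => (iii), suppose that [u z] lies in [z C^*] for every [z] in
    [eps]. Then [u] fixes every character [chi] with [chi(eps) = 1]
    ([iact_eq_of_invariant]), so the germs of [u] at these characters form an
    open set of isotropy. These germs are units by (ii), and the germ of [u] at
    the principal character of [x] is a unit only if [u x = x].

    For (iii) => (i), an open set of isotropy that contains [[s, chi]] contains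
    the germs of some [t] at the principal characters of all [z] in a set [eps]
    with [chi(eps) = 1], where moreover [[t, chi] = [s, chi]]. So [t(z)] is in
    [z C^*] for these [z], say [t(z) = z u]. Translating [eps] by [z] gives a
    set [z^-1 eps], the complement in [dmn z C] of ideals that are proper since
    they miss [dmn z]; cancelling [z] in [t(z y) = z u y] shows that [u y] lies
    in [y C^*] for [y] in [z^-1 eps]. Then (iii) at [y = dmn z] gives that [u]
    is an identity, hence [t] is the identity on [eps] ([fixed_of_invariant])
    and [[t, chi]] is a unit. *)

(** * Effective groupoids and open subgroupoids *)

Section Effective.
Variable G : etaleGroupoid.

Lemma identities_isotropy : identities G `<=` isotropy G.
Proof. by move=> v /= v1; rewrite /isotropy/= -[v in RHS]v1 tgt_dmn. Qed.

(** The unit space is the image of the domain map, a local homeomorphism. *)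
Lemma identities_open : open (identities G).
Proof.
rewrite openE => v /= v1; have [U [oU Uv _ Uop]] := dmn_etale v.
rewrite /interior nbhsE; exists (@dmn G @` U).
  by split; [exact: Uop|exists v].
by move=> _ [g _ <-]; exact: dmn_dmn.
Qed.

Lemma effectiveP : effective G <->
  forall W : set G, open W -> W `<=` isotropy G -> W `<=` identities G.
Proof.
rewrite /effective; split=> [eff W oW Wiso|H].
  by rewrite -eff; move: Wiso => /interiorS; rewrite (interior_id _).1.
apply/seteqP; split.
  by apply: H; [exact: open_interior|exact: interior_subset].
have /interior_id <- := identities_open.
exact/interiorS/identities_isotropy.
Qed.

End Effective.

(** A set that is open in an open subgroupoid is open in the whole groupoid. *)
Lemma effective_sub (G : etaleGroupoid) (H : open_subgroupoid G) :
  effective G -> effective (sub_carrier H).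
Proof.
move=> /effectiveP eff; apply/effectiveP => W /sub_openP oW Wiso g Wg.
apply: sub_val_inj; apply: (eff _ oW); last by exists g.
by move=> _ [h Wh <-]; exact: (congr1 (@sub_val _ H) (Wiso _ Wh)).
Qed.

Section LCCategory.
Variable C : lcSmallCategory.
Local Notation I := (lc_semigroup C).
Local Notation J := (lc_semilattice C).
Local Notation Om := (Omega C).
Implicit Types (x y z u v : C) (eps : set C).

(** * Invertible elements and right ideals *)

Lemma ridealP x y : rideal x y <-> exists2 a, tgt a = dmn x & y = compose x a.
Proof.
by split=> [[a [_ xa] <-]|[a xa ->]]; exists a.
Qed.

Lemma rideal_id v x : identities C v -> rideal v x <-> tgt x = v.
Proof.
move=> v1; split=> [/ridealP[a va ->]|xv].
  by rewrite tgt_comp// -v1 tgt_dmn v1.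
by apply/ridealP; exists x; rewrite ?xv// -xv comp_tgt.
Qed.

(** [z C] is the range of left multiplication by [z]. *)
Lemma Jset_rideal z : Jset C (rideal z).
Proof.
exists (Defs.pinv (lmul z)); first exact: Il_inv (Il_lmul z).
apply/seteqP; split=> [y [x [zx ->]]|_ [x [_ zx] <-]].
  by apply/ridealP; exists x.
by exists x.
Qed.

(** Left cancellation turns the two factorizations into mutually inverse
    factors. *)
Lemma rideal_antisym z w :
  rideal z w -> rideal w z -> lmulset z (invertibles C) w.
Proof.
move=> /ridealP[a az ->] /ridealP[b]; rewrite dmn_comp// => ba zE.
have zab : z = compose z (compose a b) by rewrite Defs.compA.
have ab1 : compose a b = tgt a.
  apply: (@comp_cancel _ z); rewrite ?tgt_comp ?tgt_tgt//.
  by rewrite -zab az comp_dmn.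
have ab : tgt a = dmn b by rewrite -(@dmn_comp C a b)// ab1 dmn_tgt.
exists a => //; split=> //; exists b; split=> //.
apply: (@comp_cancel _ a); rewrite ?tgt_comp ?tgt_dmn//.
by rewrite Defs.compA// ab1 comp_tgt comp_dmn.
Qed.

(** * Equivariance of the partial bijections *)

(** The equality of domains is part of the induction: the cases of a product
    and of an inverse need it to know that [y a] is defined. *)
Lemma Il_compose (s : pbij C) x y a : Il C s -> s x y -> tgt a = dmn x ->
  dmn x = dmn y /\ s (compose x a) (compose y a).
Proof.
move=> sI; elim: sI x y a => [c|{}s t sI IHs tI IHt|{}s sI IHs] x y a /=.
- move=> [cx ->] ax; rewrite dmn_comp//; split=> //.
  by rewrite tgt_comp// Defs.compA.
- move=> [w txw swy] ax; have [xw txwa] := IHt _ _ _ txw ax.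
  have [wy swya] := IHs _ _ a swy (etrans ax xw).
  by split; [rewrite xw|exists (compose w a)].
- move=> syx ax.
  have [yx _] := IHs _ _ (dmn y) syx (tgt_dmn _).
  by have [_ ?] := IHs _ _ a syx (etrans ax (esym yx)).
Qed.

Lemma Il_dmn (s : pbij C) x y : Il C s -> s x y -> dmn x = dmn y.
Proof. by move=> sI sxy; have [] := Il_compose sI sxy (tgt_dmn _). Qed.

Lemma Jset_compose (e : set C) x a : Jset C e -> e x -> tgt a = dmn x ->
  e (compose x a).
Proof.
move=> [s sI <-] [y sxy] ax; exists (compose y a).
by have [] := Il_compose sI sxy ax.
Qed.

(** A right ideal is stable under right multiplication by an invertible element
    and by its inverse. *)
Lemma Jset_mul_invertible (e : set C) z w : Jset C e ->
  lmulset z (invertibles C) w -> e w <-> e z.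
Proof.
move=> eJ [a [[b [ab ba abE baE]] az] <-]; split=> [ez|ez].
  have := Jset_compose (a := b) eJ ez.
  by rewrite dmn_comp// -Defs.compA// abE az comp_dmn; apply.
exact: Jset_compose.
Qed.

(** * Principal characters *)

Fact principal_subproof z : OmegaSet C (fun e : J => `[< (e : set C) z >]).
Proof.
split; first split.
- exists (jmk (Jset_rideal z)); apply/asboolP/ridealP; exists (dmn z).
    exact: tgt_dmn.
  by rewrite comp_dmn.
- by move=> e f; exact: asbool_and.
- by move=> e e0; apply/asboolPn; rewrite e0.
- move=> e n f eE /asboolP; rewrite eE => -[i _ fz]; exists i.
  exact/asboolP.
Qed.

Definition principal z : Om := omk (principal_subproof z).

Lemma principalE z (e : J) : principal z e = `[< (e : set C) z >].
Proof. by []. Qed.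

Lemma obar_principal z eps : Jbar C eps -> obar (principal z) eps <-> eps z.
Proof.
move=> [e [n [f [fe ->]]]]; rewrite obarP// principalE; split.
  move=> [/asboolP ez nf]; split=> // -[i _ fz].
  by have := nf i; rewrite principalE asboolT.
move=> [ez nf]; split; first exact/asboolP.
by move=> i; rewrite principalE; apply/asboolF => fz; apply: nf; exists i.
Qed.

(** The sets [eps] with [chi(eps) = 1] generate a filter on [C], along which
    the principal characters converge to [chi]: this is pointwise convergence,
    checked on one ideal [e] at a time. *)
Lemma principal_near (chi : Om) (U : set Om) : nbhs chi U ->
  exists2 eps, obar chi eps & forall z, eps z -> U (principal z).
Proof.
pose F : set_system C := [set A | exists2 eps, obar chi eps & eps `<=` A].
have FF : Filter F.
  split.
  - by have [e /obarJ che] := onz chi; exists e.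
  - move=> A B [a oa aA] [b ob bB]; exists (a `&` b); first exact: obarI.
    by move=> x [/aA Ax /bB Bx].
  - by move=> A B AB [a oa aA]; exists a => // x /aA /AB.
pose p z : {ptws J -> bool} := fun e => `[< (e : set C) z >].
have Fp : p @ F --> (oval chi : {ptws J -> bool}).
  apply/cvg_sup => e B [_ [[W oW <-]] We /filterS]; apply.
  rewrite /= in We; have [che|nche] := boolP (chi e).
    exists (e : set C); first exact: obarJ.
    by move=> z ez; rewrite /= /p asboolT// -che.
  (* As [chi(e) = 0], the set [e' \ e] has value 1 for each [e'] of value 1. *)
  have [e' che'] := onz chi.
  exists (e' `\` \bigcup_(i in [set: 'I_1]) jcap e e').
    apply: (@obar_fin _ [the finType of 'I_1] _ e' (fun=> jcap e e')) => //.
      by move=> i x [].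
    by move=> i; rewrite ocap (negbTE nche).
  move=> z [e'z nz]; rewrite /= /p asboolF; first by rewrite -(negbTE nche).
  by move=> ez; apply: nz; exists ord0.
move=> [_ [/= [W oW <-]] /= Wchi WU].
have [eps oe epsW] := Fp W (open_nbhs_nbhs (conj oW Wchi)).
by exists eps => // z /epsW Wz; apply: WU.
Qed.

(** The two characters are compared at the ideals [z C] and [w C], which gives
    the factorizations of [w] through [z] and of [z] through [w]. *)
Lemma iact_principal_eq (s : I) z w (hs : principal z (jdom s)) : s z w ->
  iact hs = principal z -> lmulset z (invertibles C) w.
Proof.
move=> szw E.
have Ee (e : J) : (e : set C) w <-> (e : set C) z.
  have := congr1 (fun chi : Om => chi e) E; rewrite iactE !principalE => {}E.
  split=> [ew|ez]; apply/asboolP.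
    by rewrite -E; apply/asboolP; exists w.
  move/asboolP: ez; rewrite -E => /asboolP[w' szw' ew'].
  by apply/asboolP; rewrite (pbij_fun szw szw').
have self (a : C) : rideal a a.
  by apply/ridealP; exists (dmn a); rewrite ?tgt_dmn ?comp_dmn.
apply: rideal_antisym.
  exact: (Ee (jmk (Jset_rideal z))).2 (self z).
exact: (Ee (jmk (Jset_rideal w))).1 (self w).
Qed.

(** If [s.chi] and [chi] differed at an ideal [e], some [z] in [eps] would have
    exactly one of [z], [s(z)] in [e]. *)
Lemma iact_eq_of_invariant (s : I) (chi : Om) eps (hs : chi (jdom s)) :
  obar chi eps ->
  (forall z w, eps z -> s z w -> lmulset z (invertibles C) w) ->
  iact hs = chi.
Proof.
move=> oe inv; apply: oval_inj; apply/funext => e; rewrite iactE.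
have H := obarI oe (obarJ hs).
apply/idP/idP => /obarJ/(obarI H)/obar_le; apply.
  move=> z [[ez _] [w szw ew]].
  by apply/(Jset_mul_invertible (jvalP e) (inv _ _ ez szw)).
move=> z [[ez [w szw]] eez]; exists w => //.
by apply/(Jset_mul_invertible (jvalP e) (inv _ _ ez szw)).
Qed.

(** * Units and isotropy among the germs *)

Lemma germ_identityP (s : I) (chi : Om) (hs : chi (jdom s)) :
  identities (germ C) (mkgerm hs) <->
  exists2 eps, obar chi eps & forall x y, eps x -> s x y -> x = y.
Proof.
rewrite /identities/= /dmn/= /gdmn gsrc_mk; split.
  move=> /mkgermE[_ /pgermP[eps oe E]]; exists eps => // x y ex sxy.
  by have [] := (E _ _ ex).2 sxy.
move=> [eps oe E]; apply/mkgermE; split=> //; case: cid => e /= che.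
apply/pgermP; exists (eps `&` jdom s `&` e).
  by apply: obarI; [apply: obarI => //|]; exact: obarJ.
move=> x y [[ex [y' sxy']] eex]; split=> [[_ <-]|sxy].
  by rewrite [X in s _ X](E _ _ ex sxy').
by split=> //; exact: E ex sxy.
Qed.

Lemma germ_isotropyP (s : I) (chi : Om) (hs : chi (jdom s)) :
  isotropy (germ C) (mkgerm hs) <-> iact hs = chi.
Proof.
rewrite /isotropy/= /dmn/= /tgt/= /gdmn /gtgt gsrc_mk grng_mk.
by split=> [/gunit_inj|->].
Qed.

(** * The three implications *)

Definition invariance_condition : Prop :=
  forall v u (n : nat) (f : 'I_n -> set C),
    identities C v -> invertibles_at v u ->
    (forall i, Jset C (f i) /\ f i `<` rideal v) ->
    (forall z, (rideal v `\` \bigcup_i f i) z ->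
      lmulset z (invertibles C) (compose u z)) ->
    forall x, (rideal v `\` \bigcup_i f i) x -> compose u x = x.

Lemma effective_core_invariance :
  effective (core_groupoid C) -> invariance_condition.
Proof.
move=> /effectiveP eff v u n f v1 [uinv [ut ud]] fJ inv x ex.
pose vJ := jmk (Jset_rideal v); pose fJ' i := jmk (fJ i).1.
have fv i : fJ' i `<=` vJ by have [_ []] := fJ i.
set eps := rideal v `\` _ in inv ex.
have epsE : eps = vJ `\` \bigcup_i fJ' i by [].
have Jeps : Jbar C eps by exists vJ, n, fJ'.
pose U : set Om := interior [set psi : Om | obar psi eps].
have domu z : rideal v z -> (jdom (igen u) : set C) z.
  move=> vz; exists (compose u z); split=> //.
  by rewrite ud (rideal_id z v1).1.
have core_slice : slice (igen u) U `<=` @core_set C.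
  move=> _ [chi [hu [_ ->]]]; exists u, chi, hu.
  by split=> //; split=> //; rewrite ut.
pose W : set (core_groupoid C) := @sub_val _ _ @^-1` slice (igen u) U.
have oW : open W.
  apply: open_comp => [g _|]; first exact: sub_val_continuous.
  exact/slice_open/open_interior.
have Wiso : W `<=` isotropy (core_groupoid C).
  move=> g [chi [hu [/interior_subset/= oe gE]]]; apply: sub_val_inj.
  rewrite -[LHS]/(dmn (sub_val g)) -[RHS]/(tgt (sub_val g)) gE.
  apply/germ_isotropyP; apply: iact_eq_of_invariant oe _ => z w ez [_ ->].
  exact: inv.
have hx : principal x (jdom (igen u)) by apply/asboolP/domu; case: ex.
have sx : slice (igen u) U (mkgerm hx).
  exists (principal x), hx; split=> //.
  exact/obar_near/obar_principal.
have /(congr1 (@sub_val _ _)) :=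
  eff W oW Wiso (@sub_mk _ (core_subgroupoid C) _ (core_slice _ sx)) sx.
move=> /germ_identityP[del odel delE].
apply/esym/(delE x); first by apply/obar_principal => //; exact: obar_Jbar odel.
by split=> //; rewrite ud (rideal_id x v1).1//; case: ex.
Qed.

(** Writing [t(z) = z u], the condition is applied to [u] and to the translate
    [z^-1 eps], which contains the identity [dmn z]. *)
Lemma fixed_of_invariant (t : I) eps : invariance_condition -> Jbar C eps ->
  (forall z w, eps z -> t z w -> lmulset z (invertibles C) w) ->
  forall z w, eps z -> t z w -> z = w.
Proof.
move=> H [e [n [f [fe epsE]]]] inv z w ez tzw.
have [a [ainv az] aw] := inv _ _ ez tzw.
have da : dmn a = dmn z by rewrite (Il_dmn (ivalP t) tzw) -aw dmn_comp.
have v1 : identities C (dmn z) by exact: dmn_dmn.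
have [eez nfz] : (e `\` \bigcup_i f i) z by rewrite -epsE.
pose g i : set C := ppre (lmul z) (f i).
have gE i y : tgt y = dmn z -> g i y <-> (f i : set C) (compose z y).
  move=> yz; split=> [[_ [_ ->]]//|fzy].
  by exists (compose z y).
have gJ i : Jset C (g i) /\ g i `<` rideal (dmn z).
  split; first exact: Jset_pre (Il_lmul z) (jvalP (f i)).
  split=> [y [_ [zy _] _]|sub]; first by apply/(rideal_id _ v1).
  apply: nfz; exists i => //; rewrite -(comp_dmn z).
  by apply/gE; rewrite ?tgt_dmn//; apply/sub/(rideal_id _ v1)/tgt_dmn.
have translate y :
    (rideal (dmn z) `\` \bigcup_i g i) y -> eps (compose z y).
  move=> [/(rideal_id _ v1) yz ngy]; rewrite epsE; split.
    exact: Jset_compose (jvalP e) eez yz.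
  by move=> [i _ /gE gy]; apply: ngy; exists i => //; exact: gy.
have fixa := H _ a _ g v1 (conj ainv (conj az da)) gJ.
have a1 : compose a (dmn z) = dmn z.
  apply: fixa => [y yE|].
    have [/(rideal_id _ v1) yz _] := yE.
    have [_ tzy] := Il_compose (ivalP t) tzw yz.
    have [b [binv]] := inv _ _ (translate _ yE) tzy.
    rewrite dmn_comp// => by_ E; exists b => //.
    apply: (@comp_cancel _ z); rewrite ?tgt_comp ?da//.
    by rewrite Defs.compA// E -aw Defs.compA// da.
  split; first by apply/(rideal_id _ v1)/tgt_dmn.
  move=> [i _ /gE]; rewrite tgt_dmn comp_dmn => /(_ erefl) fz.
  by apply: nfz; exists i.
have aE : a = dmn z by rewrite -a1 -da comp_dmn.
by rewrite -aw aE comp_dmn.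
Qed.

Lemma invariance_effective :
  invariance_condition -> effective (Il_groupoid C).
Proof.
move=> H; apply/effectiveP => W oW Wiso g Wg.
have [t [U [oU [chi [ht [Uchi ->]]] UW]]] := oW _ Wg.
have [eps oe epsU] := principal_near (open_nbhs_nbhs (conj oU Uchi)).
apply/germ_identityP; exists eps => //.
apply: (fixed_of_invariant H (obar_Jbar oe)) => z w ez tzw.
have hz : principal z (jdom t) by apply/asboolP; exists w.
apply: (iact_principal_eq (hs := hz) tzw).
apply/germ_isotropyP/Wiso/UW; exists (principal z), hz; split=> //.
exact: epsU.
Qed.

End LCCategory.

Theorem theorem4p5 (C : lcSmallCategory) :
  (effective (Il_groupoid C) <-> effective (core_groupoid C)) /\
  (effective (core_groupoid C) <->
    (forall (v u : C) (n : nat) (f : 'I_n -> set C),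
      identities C v ->
      invertibles_at v u ->
      (forall i, Jset C (f i) /\ f i `<` rideal v) ->
      (forall z, (rideal v `\` \bigcup_i f i) z ->
        lmulset z (invertibles C) (compose u z)) ->
      forall x, (rideal v `\` \bigcup_i f i) x -> compose u x = x)).
Proof.
have i_ii := @effective_sub _ (core_subgroupoid C).
have ii_iii := @effective_core_invariance C.
have iii_i := @invariance_effective C.
split; first by split=> // /ii_iii/iii_i.
by split=> // /iii_i/i_ii.
Qed.
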